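(* Let $t\ge 1$ be an integer, let $r=2t$, let $K$ be a field, let $R=K[X_1,\dots,X_{3t+3}]$, and let $\mathcal{I}\subset R$ be the edge ideal of the graph $B_{2t}$. Then the height of $\mathcal{I}$ is $$\operatorname{ht}(\mathcal{I})=\begin{cases}\frac{3}{4}r+\frac{3}{2} & \text{if } t \text{ is odd},\\[1mm] \frac{3}{4}r+1 & \text{if } t \text{ is even}.\end{cases}$$
   Context: For an integer $t\ge 1$, $B_{2t}$ is the simple graph with vertex set $\{v_1,\dots,v_{3t+3}\}$ and edge set $\{\{v_i,v_{i+1}\} : 1\le i\le 3t+2,\ i\ne t+1,\ i\neq 2t+2\}\cup\{\{v_i,v_{i+t+1}\} : 1\le i\le 2t+2\}$ (a grid of unit squares with 2 rows and $t$ columns of squares); $r=2t$ is its number of (bounded) regions. The edge ideal of a graph on $v_1,\dots,v_n$ is the ideal of $K[X_1,\dots,X_n]$ generated by all monomials $X_iX_j$ with $\{v_i,v_j\}$ an edge. *)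

(* Defs.v *)
From mathcomp Require Import all_boot all_order all_algebra.
From mathcomp Require Import boolp classical_sets.
From mathcomp Require Import mpoly.

Set Implicit Arguments.
Unset Strict Implicit.
Unset Printing Implicit Defensive.

Import Order.TTheory GRing.Theory Num.Theory.

Local Open Scope classical_set_scope.
Local Open Scope ring_scope.

Definition ideal_gen (R : comNzRingType) (S : set R) : set R :=
  [set f | exists2 s : seq (R * R), (forall p, p \in s -> S p.2)
                                  & f = \sum_(p <- s) p.1 * p.2].

(* [idealr_closed] already requires the ideal to be proper. *)
Definition prime_ideal (R : comNzRingType) (P : set R) : Prop :=
  idealr_closed (mem P) /\ prime_idealr_closed (mem P).

(* There is a chain C 0 < C 1 < ... < C k = P of prime ideals; the values of C
   beyond k are irrelevant. *)
Definition prime_chain (R : comNzRingType) (P : set R) (k : nat) : Prop :=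
  exists C : nat -> set R,
    [/\ forall i, (i <= k)%N -> prime_ideal (C i),
        forall i, (i < k)%N -> C i `<` C i.+1
      & C k = P].

Definition prime_has_height (R : comNzRingType) (P : set R) (h : nat) : Prop :=
  prime_chain P h /\ forall k, prime_chain P k -> (k <= h)%N.

(* The height of I is the minimum of the heights of the primes containing I.
   It is a relation because in a general ring the height may be infinite; a
   prime of infinite height imposes no upper bound on the minimum h. *)
Definition has_height (R : comNzRingType) (I : set R) (h : nat) : Prop :=
  (exists P : set R, [/\ prime_ideal P, I `<=` P & prime_has_height P h]) /\
  (forall (P : set R) k,
     prime_ideal P -> I `<=` P -> prime_has_height P k -> (h <= k)%N).

Lemma has_height_unique (R : comNzRingType) (I : set R) h h' :
  has_height I h -> has_height I h' -> h = h'.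
Proof.
move=> [[P [Pp IP hP]] minh] [[P' [Pp' IP' hP']] minh'].
by apply/eqP; rewrite eqn_leq (minh P') // (minh' P).
Qed.

Definition edge_ideal (K : fieldType) (n : nat) (e : rel 'I_n) :
    set {mpoly K[n]} :=
  ideal_gen [set f | exists i j : 'I_n, e i j /\ f = 'X_i * 'X_j].

Arguments edge_ideal K {n} e _.

(* Oriented edges v_a -> v_b of B_{2t}, with 1-based indices a and b. *)
Definition grid_arc (t a b : nat) : bool :=
  [&& 1 <= a <= 3 * t + 2, a != t + 1, a != 2 * t + 2 & b == a + 1]%N
  || ((1 <= a <= 2 * t + 2) && (b == a + t + 1))%N.

(* The ordinal u stands for the vertex v_(u + 1). *)
Definition grid_graph (t : nat) : rel 'I_(3 * t + 3) :=
  fun u v => grid_arc t u.+1 v.+1 || grid_arc t v.+1 u.+1.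

Arguments grid_graph t u v : clear implicits.

Lemma grid_graph_sym t : ssrbool.symmetric (grid_graph t).
Proof. by move=> u v; rewrite /grid_graph orbC. Qed.

Lemma grid_graph_irr t : irreflexive (grid_graph t).
Proof.
have ne a k : (a == a + k.+1)%N = false.
  by apply/ltn_eqF; rewrite addnS ltnS leq_addr.
have arcF a : grid_arc t a a = false.
  by rewrite /grid_arc -addnA (addn1 t) !ne !andbF.
by move=> u; rewrite /grid_graph orbb arcF.
Qed.

(* Main.v *)
(* The height of an edge ideal is the least size of a vertex cover: a prime
   containing the ideal contains the variables of some cover C, and the ideal
   (X_i, i in C) is a prime of height |C|. The upper bound on that height
   follows by prolonging chains up to (X_1, ..., X_n) from the fact that
   K[X_1, ..., X_n] has no chain P_0 < ... < P_(n+1) of primes. Otherwise pick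
   x_i in P_(i+1) but not in P_i: the monomials in x_0, ..., x_n are linearly
   independent modulo P_0, which is impossible since n + 1 polynomials in n
   variables are algebraically dependent, by counting dimensions.

   The 3 x (t + 1) grid has a Hamiltonian path, so every cover meets each of the
   (3t + 3)./2 disjoint edges joining positions 2k and 2k + 1 of the path; as the
   grid is bipartite, the vertices at odd positions form a cover of that size. *)

From HB Require Import structures.
Require Import Defs.
From mathcomp Require Import all_boot all_order all_algebra.
From mathcomp Require Import boolp classical_sets.
From mathcomp Require Import mpoly.
From mathcomp Require Import zify ring lra.

Set Implicit Arguments.
Unset Strict Implicit.
Unset Printing Implicit Defensive.

Import GRing.Theory.

Local Open Scope ring_scope.

(** * Prime ideals and chains of primes *)

Section PrimeIdeals.
Variables (R : comNzRingType) (P : set R).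
Hypothesis primeP : prime_ideal P.

Lemma prime_ideal0 : P 0.
Proof. by case: primeP => -[]; rewrite in_setE. Qed.

Lemma prime_ideal1 : ~ P 1.
Proof. by case: primeP => -[_ + _] _; rewrite notin_setE. Qed.

Lemma prime_idealMD a u v : P u -> P v -> P (a * u + v).
Proof.
case: primeP => -[_ _ cl] _ Pu Pv.
by have := cl a u v; rewrite !in_setE; apply.
Qed.

Lemma prime_idealMl a u : P u -> P (a * u).
Proof. by move=> Pu; rewrite -[a * u]addr0; apply: prime_idealMD prime_ideal0. Qed.

Lemma prime_idealD u v : P u -> P v -> P (u + v).
Proof. by move=> Pu Pv; rewrite -[u]mul1r; apply: prime_idealMD. Qed.

Lemma prime_idealM u v : P (u * v) -> P u \/ P v.
Proof.
case: primeP => _ cl Puv.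
have /cl/orP[] : u * v \in P by rewrite in_setE.
  by rewrite in_setE; left.
by rewrite in_setE; right.
Qed.

Lemma prime_idealX u k : P (u ^+ k) -> P u.
Proof.
elim: k => [/prime_ideal1//|k IHk].
by rewrite exprS => /prime_idealM[|/IHk].
Qed.

Lemma prime_ideal_sum (I : finType) (A : pred I) (F : I -> R) :
  (forall i, A i -> P (F i)) -> P (\sum_(i | A i) F i).
Proof.
by move=> PF; apply: (big_ind P) => //; [exact: prime_ideal0|exact: prime_idealD].
Qed.

Lemma prime_ideal_gen (S : set R) :
  (S `<=` P)%classic -> (ideal_gen S `<=` P)%classic.
Proof.
move=> SP _ [s sS ->]; elim: s sS => [|p s IHs] sS.
  by rewrite big_nil; exact: prime_ideal0.
rewrite big_cons; apply: prime_idealMD.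
  by apply/SP/sS; rewrite inE eqxx.
by apply: IHs => q qs; apply: sS; rewrite inE qs orbT.
Qed.

End PrimeIdeals.

Lemma prime_chain0 (R : comNzRingType) (P : set R) :
  prime_ideal P -> prime_chain P 0.
Proof. by move=> primeP; exists (fun=> P). Qed.

Lemma prime_chainS (R : comNzRingType) (P Q : set R) k :
  prime_chain P k -> prime_ideal Q -> (P `<` Q)%classic -> prime_chain Q k.+1.
Proof.
move=> [C [Cprime Clt CkP]] primeQ ltPQ.
exists (fun i => if (i <= k)%N then C i else Q); split=> [i _|i|].
- by case: ifP => // /Cprime.
- rewrite ltnS => ik; rewrite ik.
  case: ltnP => [/Clt//|ki].
  have -> : i = k by apply/eqP; rewrite eqn_leq ik.
  by rewrite CkP.
- by rewrite ltnn.
Qed.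

Lemma ker_prime_ideal (R : comNzRingType) (S : idomainType) (f : {rmorphism R -> S}) :
  prime_ideal [set x | f x = 0]%classic.
Proof.
split; [split|].
- by rewrite in_setE /= rmorph0.
- by rewrite notin_setE /= rmorph1 => /eqP; rewrite oner_eq0.
- move=> a u v; rewrite !in_setE /= => fu fv.
  by rewrite rmorphD rmorphM fu fv mulr0 addr0.
- move=> u v; rewrite in_setE /= rmorphM => /eqP.
  by rewrite mulf_eq0 => /orP[] /eqP fE; apply/orP; [left|right]; rewrite in_setE.
Qed.

(** * Algebraic dependence bounds the length of prime chains *)

(** Nested pairs, so that an induction on [m] splits off the exponent of [x 0]. *)
Fixpoint exponents (m D : nat) : finType :=
  if m is m'.+1 then ('I_D * exponents m' D)%type : finType else unit : finType.

Fixpoint monomial (R : nzRingType) (D m : nat) : (nat -> R) -> exponents m D -> R :=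
  if m is m'.+1
  then fun x e => x 0%N ^+ e.1 * monomial (fun i => x i.+1) e.2
  else fun _ _ => 1.

Lemma card_exponents m D : #|exponents m D| = (D ^ m)%N.
Proof. by elim: m => [|m IHm]; rewrite /= ?card_unit // card_prod card_ord IHm expnS. Qed.

(* Factor the least power of [x 0] out of a relation modulo [C 0]: as [x 0] is
   not in [C 0], the cofactor is in [C 0], and it is congruent modulo [x 0],
   hence modulo [C 1], to a relation between monomials in [x 1], [x 2], ... *)
Lemma chain_monomials_free (K : fieldType) (R : comAlgType K) m D
    (C : nat -> set R) (x : nat -> R) :
  (forall i, (i <= m)%N -> prime_ideal (C i)) ->
  (forall i, (i < m)%N -> (C i `<=` C i.+1)%classic) ->
  (forall i, (i < m)%N -> C i.+1 (x i) /\ ~ C i (x i)) ->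
  forall c : exponents m D -> K,
  C 0%N (\sum_e c e *: monomial x e) -> forall e, c e = 0.
Proof.
elim: m C x => [|m IHm] C x Cprime Cle Cx c Cc.
  (* Without variables the relation is a constant; a nonzero one would be a unit in [C 0]. *)
  case; apply/eqP/negPn/negP => c0; apply: (prime_ideal1 (Cprime 0%N isT)).
  move: Cc; rewrite (bigD1 tt) //= big1 => [|[]//]; rewrite addr0 => Cc.
  have := prime_idealMl (Cprime 0%N isT) (c tt)^-1%:A Cc.
  by rewrite -scalerAl mul1r scalerA mulVf // scale1r.
pose f (i : 'I_D) :=
  \sum_(e : exponents m D) c (i, e) *: monomial (fun j => x j.+1) e.
have {}Cc : C 0%N (\sum_(i < D) x 0%N ^+ i * f i).
  congr (C 0%N _): Cc; under [RHS]eq_bigr do rewrite mulr_sumr.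
  by rewrite pair_big; apply: eq_bigr => -[i e] _; rewrite /= scalerAr.
(* The induction hypothesis is used for the chain and the elements shifted by one. *)
have free1 i : C 1%N (f i) -> forall e, c (i, e) = 0.
  apply: (IHm (fun i => C i.+1) (fun j => x j.+1)) => j jm.
  - exact: Cprime.
  - exact: Cle.
  - exact: Cx.
(* Coefficients are killed by increasing exponent of [x 0]: once those below [k] vanish, [x 0 ^+ k]
   factors out. *)
suff c0 k : forall i : 'I_D, (i < k)%N -> forall e, c (i, e) = 0.
  by case=> i e; apply: (c0 D).
elim: k => // k IHk i; rewrite ltnS leq_eqVlt => /predU1P[ik|/IHk//].
apply: free1.
have [C1 C0] := Cx 0%N isT.
have f0 (j : 'I_D) : (j < k)%N -> f j = 0.
  by move=> jk; rewrite /f big1 // => e _; rewrite IHk // scale0r.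
(* The cofactor of [x 0 ^+ k] is [f i + g], and each term of [g] keeps a factor [x 0], which lies in
   [C 1]. *)
pose g := \sum_(j < D | (k < j)%N) x 0%N ^+ (j - k) * f j.
have [] : C 0%N (x 0%N ^+ k) \/ C 0%N (f i + g).
  apply: (prime_idealM (Cprime 0%N isT)).
  congr (C 0%N _): Cc; rewrite (bigD1 i) //= mulrDr ik; congr (_ + _).
  rewrite /g mulr_sumr [RHS]big_mkcond [LHS]big_mkcond; apply: eq_bigr => j _.
  rewrite -val_eqE /= ik; case: ltngtP => // [kj|jk]; last by rewrite f0 // mulr0.
  by rewrite mulrA -exprD subnKC // ltnW.
- by move/(prime_idealX (Cprime 0%N isT)).
move=> /(Cle 0%N isT) C1f.
have C1g : C 1%N g.
  apply: (prime_ideal_sum (Cprime 1%N isT)) => j kj.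
  rewrite -(subnSK kj) exprS -mulrA mulrC.
  exact: (prime_idealMl (Cprime 1%N isT)).
have := prime_idealMD (Cprime 1%N isT) (-1) C1g C1f.
by rewrite mulN1r addrC addrK.
Qed.

(** A matrix with more rows than columns has a nonzero left kernel. *)
Lemma linear_dependence (K : fieldType) (I J : finType) (A : I -> J -> K) :
  (#|J| < #|I|)%N ->
  exists2 c : I -> K, (exists i, c i != 0) & forall j, \sum_i c i * A i j = 0.
Proof.
move=> ltJI; pose M := \matrix_(i < #|I|, j < #|J|) A (enum_val i) (enum_val j).
have : kermx M != 0.
  by rewrite kermx_eq0 /row_free neq_ltn (leq_ltn_trans (rank_leq_col M)).
case/rowV0Pn => v /sub_kermxP vM v0.
exists (fun i => v 0 (enum_rank i)).
  by have /rV0Pn[i vi] := v0; exists (enum_val i); rewrite enum_valK.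
move=> j; move/matrixP/(_ 0 (enum_rank j)): vM; rewrite !mxE => vMj.
rewrite -[RHS]vMj (reindex (@enum_val I I)) /=; last exact: onW_bij (enum_val_bij I).
by apply: eq_bigr => i _; rewrite enum_valK mxE !enum_rankK.
Qed.

(** [msize] is the degree plus one, and each of the [m] powers has exponent below [D], hence degree
    at most [D * d]. *)
Lemma msize_monomial (K : fieldType) n d D m (x : nat -> {mpoly K[n]}) :
  (forall i, (i < m)%N -> (msize (x i) <= d.+1)%N) ->
  forall e : exponents m D, (msize (monomial x e) <= (m * D * d).+1)%N.
Proof.
have msizeMle (p q : {mpoly K[n]}) a b :
    (msize p <= a.+1 -> msize q <= b.+1 -> msize (p * q) <= (a + b).+1)%N.
  have [->|p0] := eqVneq p 0; first by rewrite mul0r msize0.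
  have [->|q0] := eqVneq q 0; first by rewrite mulr0 msize0.
  rewrite msizeM // => pa qb; by rewrite -subn1 leq_subLR add1n -addnS -addSn leq_add.
elim: m x => [|m IHm] x xd e /=; first by rewrite msize1.
rewrite !mulSn mulnDl; apply: (msizeMle); last by apply: IHm => i im; apply: xd.
apply: (@leq_trans (e.1 * d).+1); last by rewrite ltnS leq_mul2r ltnW ?orbT.
elim: (nat_of_ord e.1) => [|k IHk]; first by rewrite expr0 msize1.
by rewrite exprS mulSn; apply: (msizeMle) => //; apply: xd.
Qed.

Lemma monomials_dependent (K : fieldType) n (x : nat -> {mpoly K[n]}) :
  exists D, exists2 c : exponents n.+1 D -> K,
    (exists e, c e != 0) & \sum_e c e *: monomial x e = 0.
Proof.
pose d := \max_(i < n.+1) msize (x i).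
(* With N = [n.+1 * d + 1], the choice D > N^n gives D^(n+1) > (N D)^n: there are more products than
   exponent vectors with entries below B = N D, and these cover all degrees that occur. *)
pose D := ((n.+1 * d + 1) ^ n).+1; exists D.
pose B := ((n.+1 * d + 1) * D)%N.
pose toM (j : {ffun 'I_n -> 'I_B}) : 'X_{1..n} := [multinom (j i : nat) | i < n].
have [|c c0 cA] := @linear_dependence K (exponents n.+1 D) _
  (fun e j => (monomial x e)@_(toM j)).
  rewrite card_exponents card_ffun !card_ord expnMn expnS ltn_mul2r.
  by rewrite expn_gt0 /= ltnSn.
exists c => //; apply/mpolyP => m; rewrite mcoeff0.
have mcoeffE : (\sum_e c e *: monomial x e)@_m = \sum_e c e * (monomial x e)@_m.
  by rewrite raddf_sum; apply: eq_bigr => e _; rewrite -mcoeffZ.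
have [mB|Bm] := ltnP (mdeg m) B; last first.
  rewrite mcoeffE big1 // => e _; rewrite memN_msupp_eq0 ?mulr0 //.
  apply: msize_mdeg_ge; apply: leq_trans Bm.
  apply: leq_trans (@msize_monomial _ _ d D _ x _ e) _ => [i ilt|].
    by apply: leqW; apply: (leq_bigmax (Ordinal ilt)).
  rewrite /B; lia.
have mi i : (m i < B)%N.
  by apply: leq_ltn_trans mB; rewrite mdegE (bigD1 i) //= leq_addr.
rewrite mcoeffE -[RHS](cA [ffun i => Ordinal (mi i)]).
apply: eq_bigr => e _; congr (_ * mcoeff _ _).
by apply/mnmP => i; rewrite mnmE ffunE.
Qed.

Lemma prime_chain_mpoly_le (K : fieldType) n (P : set {mpoly K[n]}) k :
  prime_chain P k -> (k <= n)%N.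
Proof.
move=> [C [Cprime Clt _]]; rewrite leqNgt; apply/negP => nk.
have Cx i : exists x, (i < k)%N -> C i.+1 x /\ ~ C i x.
  (* Past the end of the chain, 0 is a dummy value. *)
  have [ik|] := ltnP i k; last by exists 0.
  have [_ /existsNP[x /not_implyP[Cx Cnx]]] := Clt i ik.
  by exists x.
have [x {}Cx] := choice Cx.
have [D [c [e /negP c0] c_rel]] := monomials_dependent x.
apply: c0; apply/eqP; apply: (@chain_monomials_free _ _ _ _ C x) => [i im|i im|i im|].
- by apply: Cprime; apply: leq_trans im _.
- by have [] := Clt i (leq_trans im nk).
- by apply: Cx; apply: leq_trans im _.
- by rewrite c_rel; apply: prime_ideal0; apply: Cprime.
Qed.

(** * Ideals generated by variables and the height of edge ideals *)

Section VariableIdeals.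
Variables (K : fieldType) (n : nat).
Implicit Types C S T : {set 'I_n}.

Definition kill_vars S : {mpoly K[n]} -> {mpoly K[n]} :=
  comp_mpoly [tuple if i \in S then 0 else 'X_i | i < n].

HB.instance Definition _ S := GRing.RMorphism.on (kill_vars S).

(** This is the ideal generated by the ['X_i] with [i] in [S]; as the kernel of a map to a domain it
    is prime at once. *)
Definition var_ideal S : set {mpoly K[n]} := [set f | kill_vars S f = 0]%classic.

Lemma kill_varsX S i : kill_vars S 'X_i = if i \in S then 0 else 'X_i.
Proof. by rewrite /kill_vars comp_mpolyXU -tnth_nth tnth_mktuple. Qed.

Lemma var_ideal_prime S : prime_ideal (var_ideal S).
Proof. exact: ker_prime_ideal. Qed.

Lemma var_idealX S i : var_ideal S 'X_i <-> i \in S.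
Proof.
rewrite /var_ideal /= kill_varsX; case: ifP => // _; split=> // /eqP.
by rewrite -msize_poly_eq0 msizeX.
Qed.

(** Modulo [P], each [f] is congruent to [kill_vars S f]: this holds for constants and variables and
    passes to sums and products. *)
Lemma var_ideal_min S (P : set {mpoly K[n]}) :
  prime_ideal P -> (forall i, i \in S -> P 'X_i) -> (var_ideal S `<=` P)%classic.
Proof.
move=> primeP PX.
pose Q (f : {mpoly K[n]}) := P (f - kill_vars S f).
have Q1 : Q 1 by rewrite /Q rmorph1 subrr; exact: prime_ideal0.
have QM f g : Q f -> Q g -> Q (f * g).
  rewrite /Q rmorphM => Qf Qg.
  have -> : f * g - kill_vars S f * kill_vars S g =
      f * (g - kill_vars S g) + kill_vars S g * (f - kill_vars S f) by ring.
  by apply: prime_idealMD => //; apply: prime_idealMl.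
have QX i : Q 'X_i.
  rewrite /Q kill_varsX; case: ifP => [/PX|_]; rewrite ?subr0 // subrr.
  exact: prime_ideal0.
have Qall f : Q f.
  rewrite [f]mpolyE; apply: (big_ind Q) => [|g h Qg Qh|m _].
  - by rewrite /Q rmorph0 subrr; exact: prime_ideal0.
  - by rewrite /Q rmorphD opprD addrACA; apply: prime_idealD.
  - rewrite -mul_mpolyC; apply: (QM).
      by rewrite /Q /kill_vars comp_mpolyC subrr; exact: prime_ideal0.
    rewrite mpolyXE_id; apply: (big_ind Q) => // i _.
    by elim: (m i) => [|k IHk]; rewrite ?expr0 // exprS; apply: QM.
by move=> f f0; have := Qall f; rewrite /Q f0 subr0.
Qed.

(** Adding the variables of [T :\: S] one at a time enlarges the ideal strictly at each step. *)
Lemma prime_chain_var_ideal S T k : S \subset T ->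
  prime_chain (var_ideal S) k -> prime_chain (var_ideal T) (k + #|T :\: S|).
Proof.
move: {2}#|_| (erefl #|T :\: S|) => m; elim: m S k => [|m IHm] S k cardTS ST chainS.
  rewrite cardTS addn0; have -> // : T = S.
  by apply/eqP; rewrite finset.eqEsubset ST andbT -finset.setD_eq0 -cards_eq0 cardTS.
have [i iTS] : exists i, i \in T :\: S by apply/card_gt0P; rewrite cardTS.
move: (iTS); rewrite inE => /andP[iS iT].
have cardTiS : #|T :\: (i |: S)| = m.
  by move: cardTS; rewrite (cardsD1 i) iTS finset.setDDl finset.setUC => -[].
rewrite cardTS addnS -addSn -cardTiS; apply: IHm => //.
  by rewrite finset.subUset finset.sub1set iT.
apply: prime_chainS chainS (var_ideal_prime _) _; split.
  apply: var_ideal_min (var_ideal_prime _) _ => j jS.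
  by apply/var_idealX; rewrite finset.in_setU jS orbT.
move/(_ 'X_i) => sub; move/negP: iS; apply.
by apply/var_idealX/sub/var_idealX; rewrite finset.setU11.
Qed.

Lemma var_ideal_height S : prime_has_height (var_ideal S) #|S|.
Proof.
split=> [|k chainS].
  have := @prime_chain_var_ideal finset.set0 S 0 (finset.sub0set _).
  by rewrite finset.setD0; apply; apply: prime_chain0 (var_ideal_prime _).
have /prime_chain_mpoly_le := prime_chain_var_ideal (finset.subsetT S) chainS.
rewrite finset.setTD cardsCs finset.setCK card_ord.
by have := max_card (mem S); rewrite card_ord; lia.
Qed.

(** [P] contains [var_ideal S], so a chain of length [#|S|] ending there either ends at [P] or is
    prolonged by [P]. *)
Lemma card_vars_le_height S (P : set {mpoly K[n]}) k :
  prime_ideal P -> (forall i, i \in S -> P 'X_i) -> prime_has_height P k -> (#|S| <= k)%N.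
Proof.
move=> primeP PX [_ maxk]; have [chainS _] := var_ideal_height S.
have SP := var_ideal_min primeP PX.
have [PS|PS] := pselect (P `<=` var_ideal S)%classic.
  by apply: maxk; have -> : P = var_ideal S by apply/seteqP.
by apply/ltnW/maxk; apply: prime_chainS chainS primeP _.
Qed.

Lemma has_height_edge_ideal (e : rel 'I_n) C :
  (forall i j, e i j -> (i \in C) || (j \in C)) ->
  (forall S, (forall i j, e i j -> (i \in S) || (j \in S)) -> #|C| <= #|S|)%N ->
  has_height (edge_ideal K e) #|C|.
Proof.
move=> coverC minC; split.
  exists (var_ideal C); split; [exact: var_ideal_prime| |exact: var_ideal_height].
  apply: prime_ideal_gen (var_ideal_prime _) _ _ => _ [i [j [/coverC ij ->]]].
  case/orP: ij => /var_idealX => [iC|jC].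
    by rewrite mulrC; apply: prime_idealMl (var_ideal_prime _) _ _ _.
  exact: prime_idealMl (var_ideal_prime _) _ _ _.
move=> P k primeP IP heightP.
pose S : {set 'I_n} := finset (fun i => `[< P 'X_i >]).
apply: (@leq_trans #|S|); last first.
  by apply: card_vars_le_height heightP => // i; rewrite finset.inE => /asboolP.
apply: minC => i j eij; rewrite !finset.inE.
have : P ('X_i * 'X_j).
  apply: IP; exists [:: (1, 'X_i * 'X_j)]; last by rewrite big_seq1 mul1r.
  by move=> p; rewrite inE => /eqP ->; exists i, j.
by move/(prime_idealM primeP) => [] PX; apply/orP; [left|right]; apply/asboolP.
Qed.

End VariableIdeals.

(** * Minimum vertex covers of the grid *)

(* The position of vertex [u] along the Hamiltonian path that runs through the
   rows of the grid, the middle one backwards. It is an involution, so it is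
   also the vertex at position [u]. *)
Definition snake (t u : nat) : nat :=
  if (t < u <= 2 * t + 1)%N then (3 * t + 2 - u)%N else u.

Lemma snakeK t : involutive (snake t).
Proof. by move=> u; rewrite /snake; case: (boolP (t < u <= _)%N) => ?; case: ifP; lia. Qed.

Lemma snake_lt t (u : 'I_(3 * t + 3)) : (snake t u < 3 * t + 3)%N.
Proof. by have := ltn_ord u; rewrite /snake; case: ifP; lia. Qed.

(** Edges within a row join consecutive positions; edges between rows join positions with sum
    [2 * t + 1] or [4 * t + 3]. *)
Lemma odd_snake_grid t u v : grid_graph t u v -> odd (snake t u) != odd (snake t v).
Proof. by rewrite /grid_graph /grid_arc /snake => uv; case: ifP; case: ifP; lia. Qed.

Lemma grid_cover_ge t (S : {set 'I_(3 * t + 3)}) :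
  (forall i j, grid_graph t i j -> (i \in S) || (j \in S)) ->
  ((3 * t + 3)./2 <= #|S|)%N.
Proof.
move=> coverS.
have vertex p : (p < 3 * t + 3)%N -> exists u : 'I_(3 * t + 3), snake t u = p.
  by move=> lt; exists (Ordinal (snake_lt (Ordinal lt))); rewrite /= snakeK.
(* Positions [k.*2] and [k.*2.+1] both have half [k], which makes the chosen vertices distinct. *)
have inS (k : 'I_(3 * t + 3)./2) : exists2 u, u \in S & (snake t u)./2 = k.
  have [|u uE] := @vertex k.*2; first by have := ltn_ord k; lia.
  have [|v vE] := @vertex k.*2.+1; first by have := ltn_ord k; lia.
  have /coverS/orP[uS|vS] : grid_graph t u v.
    rewrite /grid_graph /grid_arc; move: uE vE (ltn_ord k); rewrite /snake; case: ifP; case: ifP; lia.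
  - by exists u; rewrite // uE; lia.
  - by exists v; rewrite // vE; lia.
have [f fP] := choice
  (fun k => let: ex_intro2 u uS uk := inS k in ex_intro _ u (conj uS uk)).
rewrite -[X in (X <= _)%N]card_ord -(card_imset predT (f := f)).
  apply/subset_leq_card/fintype.subsetP => _ /finset.imsetP[k _ ->].
  by have [] := fP k.
move=> k l kl; apply/val_inj.
by have [_ fk] := fP k; have [_ fl] := fP l; rewrite /= -fk kl.
Qed.

(** An odd position [p] below [3 * t + 3] is determined by [p./2], which is below
    [(3 * t + 3)./2]. *)
Lemma card_odd_snake t :
  (#|[set u : 'I_(3 * t + 3) | odd (snake t u)]%SET| <= (3 * t + 3)./2)%N.
Proof.
(* The successor form is what [inord] requires. *)
have -> : (3 * t + 3)./2 = (3 * t + 1)./2.+1 by lia.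
rewrite -[X in (_ <= X)%N]card_ord.
pose f (u : 'I_(3 * t + 3)) : 'I_((3 * t + 1)./2.+1) := inord (snake t u)./2.
rewrite -(card_in_imset (f := f)); first exact: max_card.
move=> u v; rewrite !finset.inE => odd_u odd_v /(congr1 val).
have := snake_lt u; have := snake_lt v => lt_v lt_u.
rewrite /= !inordK; try lia; move=> uv; apply: val_inj.
by apply: (can_inj (@snakeK t)) => /=; lia.
Qed.

Theorem corollary3p4 (t : nat) (t_ge1 : (1 <= t)%N) (K : fieldType) :
  let r : rat := (2 * t)%N%:R in
  exists2 h : nat,
    has_height (edge_ideal K (grid_graph t)) h
    & h%:R = if odd t then 3 / 4 * r + 3 / 2 else 3 / 4 * r + 1.
Proof.
move=> r; pose C := [set u : 'I_(3 * t + 3) | odd (snake t u)]%SET.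
have coverC i j : grid_graph t i j -> (i \in C) || (j \in C).
  by move/odd_snake_grid; rewrite !finset.inE; do 2!case: odd.
exists #|C|.
  apply: has_height_edge_ideal => // S /grid_cover_ge.
  exact: leq_trans (card_odd_snake t).
have -> : #|C| = (3 * t + 3)./2.
  by apply/eqP; rewrite eqn_leq card_odd_snake grid_cover_ge.
(* Writing t as 2q + 1 or 2q evaluates the floor [(3 * t + 3)./2] to 3q + 3 or 3q + 1. *)
rewrite {}/r; move: (t./2) (odd_double_half t) => q; case: (odd t) => /= <-.
  have -> : (3 * (1 + q.*2) + 3)./2 = (3 * q + 3)%N by lia.
  by rewrite -muln2; lra.
have -> : (3 * (0 + q.*2) + 3)./2 = (3 * q + 1)%N by lia.
by rewrite -muln2; lra.
Qed.
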